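(* Let $\mathbf{x},\mathbf{y}$ be the random vectors in $\mathbb{R}^N$ of the measurement model described in the context, with graph Fourier transforms $\tilde{\mathbf{x}}=\mathbf{V}^T\mathbf{x}$ and $\tilde{\mathbf{y}}=\mathbf{V}^T\mathbf{y}$, and suppose that $\mathbf{C}_{\tilde{\mathbf{y}}\tilde{\mathbf{y}}}$ and $\mathbf{D}_{\tilde{\mathbf{y}}\tilde{\mathbf{y}}}$ are non-singular. If $$\mathbf{C}_{\tilde{\mathbf{x}}\tilde{\mathbf{y}}}\mathbf{C}_{\tilde{\mathbf{y}}\tilde{\mathbf{y}}}^{-1}=\mathrm{diag}(\mathbf{d}_{\tilde{\mathbf{x}}\tilde{\mathbf{y}}})\,\mathbf{D}_{\tilde{\mathbf{y}}\tilde{\mathbf{y}}}^{-1},$$ then the GSP-LMMSE estimator coincides with the LMMSE estimator, i.e. $\hat{\mathbf{x}}^{(\mathrm{GSP\text{-}LMMSE})}=\hat{\mathbf{x}}^{(\mathrm{LMMSE})}$ as functions of $\mathbf{y}$.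
   Context: Graph: $\mathcal{G}$ is an undirected connected weighted graph on $N$ vertices with symmetric non-negative weighted adjacency matrix $\mathbf{W}\in\mathbb{R}^{N\times N}$ and Laplacian $\mathbf{L}=\mathrm{diag}(\mathbf{W}\mathbf{1})-\mathbf{W}$. Its eigenvalue decomposition is $\mathbf{L}=\mathbf{V}\boldsymbol{\Lambda}\mathbf{V}^T$, where $\boldsymbol{\Lambda}$ is diagonal with $0=\lambda_1<\lambda_2\le\dots\le\lambda_N$ and $\mathbf{V}$ is orthogonal ($\mathbf{V}^T=\mathbf{V}^{-1}$). The graph Fourier transform (GFT) of $\mathbf{a}\in\mathbb{R}^N$ is $\tilde{\mathbf{a}}=\mathbf{V}^T\mathbf{a}$. Model: $\mathbf{y}=\mathbf{g}(\mathbf{L},\mathbf{x})+\mathbf{w}$, where $\mathbf{g}:\mathbb{R}^{N\times N}\times\mathbb{R}^N\to\mathbb{R}^N$ is a known (measurable) function, $\mathbf{x}$ is a random vector in $\mathbb{R}^N$, and $\mathbf{w}$ is a zero-mean random noise vector in $\mathbb{R}^N$ independent of $\mathbf{x}$; all random vectors have finite second moments. Notation: $\mathbf{C}_{\mathbf{a}\mathbf{b}}=\mathbb{E}[(\mathbf{a}-\mathbb{E}[\mathbf{a}])(\mathbf{b}-\mathbb{E}[\mathbf{b}])^T]$. For a vector $\mathbf{a}$, $\mathrm{diag}(\mathbf{a})$ is the diagonal matrix with diagonal $\mathbf{a}$; for a matrix $\mathbf{A}$, $\mathrm{diag}(\mathbf{A})$ is the vector of its diagonal entries. Put $\mathbf{d}_{\tilde{\mathbf{x}}\tilde{\mathbf{y}}}=\mathrm{diag}(\mathbf{C}_{\tilde{\mathbf{x}}\tilde{\mathbf{y}}})$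 and $\mathbf{D}_{\tilde{\mathbf{y}}\tilde{\mathbf{y}}}=\mathrm{diag}(\mathrm{diag}(\mathbf{C}_{\tilde{\mathbf{y}}\tilde{\mathbf{y}}}))$. Estimators: the LMMSE estimator minimizes $\mathbb{E}\|\hat{\mathbf{x}}-\mathbf{x}\|^2$ among affine functions of $\mathbf{y}$; when $\mathbf{C}_{\mathbf{y}\mathbf{y}}$ is non-singular it is $$\hat{\mathbf{x}}^{(\mathrm{LMMSE})}=\mathbb{E}[\mathbf{x}]+\mathbf{C}_{\mathbf{x}\mathbf{y}}\mathbf{C}_{\mathbf{y}\mathbf{y}}^{-1}(\mathbf{y}-\mathbb{E}[\mathbf{y}]).$$ The GSP-LMMSE estimator minimizes $\mathbb{E}\|\hat{\mathbf{x}}-\mathbf{x}\|^2$ among estimators $\hat{\mathbf{x}}=\mathbf{V}\mathbf{F}\mathbf{V}^T\mathbf{y}+\mathbf{b}$ with $\mathbf{F}$ a real diagonal $N\times N$ matrix and $\mathbf{b}\in\mathbb{R}^N$; when $\mathbf{D}_{\tilde{\mathbf{y}}\tilde{\mathbf{y}}}$ is non-singular it is $$\hat{\mathbf{x}}^{(\mathrm{GSP\text{-}LMMSE})}=\mathbb{E}[\mathbf{x}]+\mathbf{V}\,\mathrm{diag}(\mathbf{d}_{\tilde{\mathbf{x}}\tilde{\mathbf{y}}})\,\mathbf{D}_{\tilde{\mathbf{y}}\tilde{\mathbf{y}}}^{-1}\mathbf{V}^T(\mathbf{y}-\mathbb{E}[\mathbf{y}]).$$ *)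

(* Defs.v *)
From HB Require Import structures.
From mathcomp Require Import all_boot all_order all_algebra.
From mathcomp Require Import all_classical all_reals all_analysis.

Set Implicit Arguments.
Unset Strict Implicit.
Unset Printing Implicit Defensive.

Import Order.TTheory GRing.Theory Num.Theory.
Import numFieldNormedType.Exports.

Local Open Scope classical_set_scope.
Local Open Scope ring_scope.

(* The topological space S seen as a measurable space with its Borel
   sigma-algebra; the carrier is (convertible to) S itself. *)
Notation borel S := (g_sigma_algebraType (@open S)).

Section Graph.
Context {R : realType} {N : nat}.
Implicit Types W V : 'M[R]_N.

(* The diagonal of W is left free: self-loops cancel out in the Laplacian. *)
Record connected_weighted_graph W : Prop := ConnectedWeightedGraph {
  weight_sym : W^T = W;
  weight_ge0 : forall i j, 0 <= W i j;
  weight_connected : forall i j, connect (fun k l => 0 < W k l) i j }.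

Definition laplacian W : 'M[R]_N := diag_mx (W *m const_mx 1 : 'cV_N)^T - W.

(* Indices start at 0, so the first eigenvalue, lambda_1 = 0, is [lam 0 i]
   with [i = 0 :> nat]. *)
Record laplacian_evd W V (lam : 'rV[R]_N) : Prop := LaplacianEVD {
  evd_orthogonal : V^T *m V = 1%:M;
  evd_laplacian : laplacian W = V *m diag_mx lam *m V^T;
  evd_first : forall i : 'I_N, i = 0%N :> nat -> lam 0 i = 0;
  evd_gt0 : forall i : 'I_N, (0 < i)%N -> 0 < lam 0 i;
  evd_sorted : forall i j : 'I_N, (i <= j)%N -> lam 0 i <= lam 0 j }.

Definition gft V (a : 'cV[R]_N) : 'cV[R]_N := V^T *m a.

Definition diagv (A : 'M[R]_N) : 'rV[R]_N := \row_i A i i.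

End Graph.

Section RandomVectors.
Context {d : measure_display} {T : measurableType d} {R : realType}.
Variable P : probability T R.

Definition random_vector N (a : T -> 'cV[R]_N) : Prop :=
  measurable_fun [set: T] (a : T -> borel 'cV[R]_N).

Definition finite_second_moment N (a : T -> 'cV[R]_N) : Prop :=
  forall i, (fun t => a t i 0) \in Lfun P 2%:E.

Definition independent N M (a : T -> 'cV[R]_N) (b : T -> 'cV[R]_M) : Prop :=
  forall (A : set (borel 'cV[R]_N)) (B : set (borel 'cV[R]_M)),
    measurable A -> measurable B ->
    P (a @^-1` A `&` b @^-1` B) = (P (a @^-1` A) * P (b @^-1` B))%E.

(* [fine] is harmless on the expectations and covariances below when the
   vectors have finite second moments. *)
Definition mean N (a : T -> 'cV[R]_N) : 'cV[R]_N :=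
  \col_i fine 'E_P[fun t => a t i 0].

Definition cov N M (a : T -> 'cV[R]_N) (b : T -> 'cV[R]_M) : 'M[R]_(N, M) :=
  \matrix_(i, j) fine (covariance P (fun t => a t i 0) (fun t => b t j 0)).

End RandomVectors.

Section Estimators.
Context {d : measure_display} {T : measurableType d} {R : realType} {N : nat}.
Variable P : probability T R.
Implicit Types (V : 'M[R]_N) (x y : T -> 'cV[R]_N) (h : 'cV[R]_N -> 'cV[R]_N).

(* The library's norm on matrices is the sup norm; this is the squared
   Euclidean one. *)
Definition sqnorm (a : 'cV[R]_N) : R := \sum_i a i 0 ^+ 2.

Definition mse x y h : \bar R := 'E_P[fun t => sqnorm (h (y t) - x t)].

Definition affine_estimator h : Prop :=
  exists (A : 'M[R]_N) (b : 'cV[R]_N), h = (fun u => A *m u + b).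

Definition gsp_estimator V h : Prop :=
  exists (f : 'rV[R]_N) (b : 'cV[R]_N),
    h = (fun u => V *m diag_mx f *m V^T *m u + b).

Definition is_lmmse x y h : Prop :=
  affine_estimator h /\
  forall h', affine_estimator h' -> (mse x y h <= mse x y h')%E.

Definition is_gsp_lmmse V x y h : Prop :=
  gsp_estimator V h /\
  forall h', gsp_estimator V h' -> (mse x y h <= mse x y h')%E.

Definition lmmse x y : 'cV[R]_N -> 'cV[R]_N := fun u =>
  mean P x + cov P x y *m invmx (cov P y y) *m (u - mean P y).

Definition gsp_lmmse V x y : 'cV[R]_N -> 'cV[R]_N := fun u =>
  let xt := gft V \o x in let yt := gft V \o y in
  mean P x + V *m diag_mx (diagv (cov P xt yt))
               *m invmx (diag_mx (diagv (cov P yt yt))) *m V^T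
               *m (u - mean P y).

End Estimators.

(* Main.v *)
(* Orthogonality principle: the error of the LMMSE estimator is centred and
   uncorrelated with y, so the mean square error of any affine estimator exceeds
   that of the LMMSE one by E|D|^2, where D is the difference of the two
   estimates; when C_yy is non-singular, this excess vanishes only for equal
   estimators.  The hypothesis on the covariances, conjugated by V, says that the
   GSP-LMMSE and LMMSE formulas agree; GSP estimators being affine, optimality
   and uniqueness of the former follow from those of the latter. *)
Require Import Defs.
From HB Require Import structures.
From mathcomp Require Import all_boot all_order all_algebra.
From mathcomp Require Import all_classical all_reals all_analysis.

Set Implicit Arguments.
Unset Strict Implicit.
Unset Printing Implicit Defensive.

Import Order.TTheory GRing.Theory Num.Theory.
Import numFieldNormedType.Exports.

Local Open Scope classical_set_scope.
Local Open Scope ring_scope.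

(** * Covariances of square-integrable real variables, taken in [R] through [fine] *)

Section RealCovariance.
Context {d : measure_display} {T : measurableType d} {R : realType}.
Variable P : probability T R.
Implicit Types X Y Z : T -> R.

Lemma Lfun2_Lfun1 X : X \in Lfun P 2%:E -> X \in Lfun P 1.
Proof. by apply: Lfun_subset12; exact: fin_num_measure. Qed.

Lemma covariance_fin_num2 X Y : X \in Lfun P 2%:E -> Y \in Lfun P 2%:E ->
  covariance P X Y \is a fin_num.
Proof.
move=> X2 Y2; apply: covariance_fin_num.
- exact: Lfun2_Lfun1.
- exact: Lfun2_Lfun1.
- exact: Lfun2_mul_Lfun1.
Qed.

Lemma fine_covarianceDl X Y Z :
    X \in Lfun P 2%:E -> Y \in Lfun P 2%:E -> Z \in Lfun P 2%:E ->
  fine (covariance P (X \+ Y) Z) =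
  fine (covariance P X Z) + fine (covariance P Y Z).
Proof. by move=> X2 Y2 Z2; rewrite covarianceDl// fineD ?covariance_fin_num2. Qed.

Lemma fine_covarianceZl k X Z : X \in Lfun P 2%:E -> Z \in Lfun P 2%:E ->
  fine (covariance P (k \o* X) Z) = k * fine (covariance P X Z).
Proof.
move=> X2 Z2; rewrite covarianceZl; first by rewrite fineM ?covariance_fin_num2.
- exact: Lfun2_Lfun1.
- exact: Lfun2_Lfun1.
- exact: Lfun2_mul_Lfun1.
Qed.

Lemma Lfun2_scale k X : X \in Lfun P 2%:E -> (k \o* X) \in Lfun P 2%:E.
Proof. by move=> X2; apply: Lfun_scale => //; rewrite ler1n. Qed.

Lemma Lfun2_sum (I : Type) (s : seq I) (F : I -> T -> R) :
    (forall i, F i \in Lfun P 2%:E) ->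
  (fun t => \sum_(i <- s) F i t) \in Lfun P 2%:E.
Proof.
move=> F2; rewrite (_ : (fun _ => _) = \sum_(i <- s) F i); last first.
  by apply/funext => t; rewrite fct_sumE.
by apply: rpred_sum => [|le12 i _]; [rewrite lee1n|exact: F2].
Qed.

Lemma fine_covariance_suml (I : Type) (s : seq I) (F : I -> T -> R) Z :
    (forall i, F i \in Lfun P 2%:E) -> Z \in Lfun P 2%:E ->
  fine (covariance P (fun t => \sum_(i <- s) F i t) Z) =
  \sum_(i <- s) fine (covariance P (F i) Z).
Proof.
move=> F2 Z2; elim: s => [|i s IHs].
  rewrite big_nil (_ : (fun _ => _) = cst 0) ?covariance_cst_l//.
  by apply/funext => t; rewrite big_nil.
rewrite big_cons -IHs -fine_covarianceDl ?Lfun2_sum//.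
by congr (fine (covariance _ _ _)); apply/funext => t; rewrite big_cons.
Qed.

Lemma expectation_sum_fun (I : Type) (s : seq I) (F : I -> T -> R) :
    (forall i, F i \in Lfun P 1) ->
  ('E_P[fun t => (\sum_(i <- s) F i t)%R] = \sum_(i <- s) 'E_P[F i])%E.
Proof.
move=> F1; elim: s => [|i s IHs].
  rewrite big_nil (_ : (fun _ => _) = cst 0) ?expectation_cst//.
  by apply/funext => t; rewrite big_nil.
rewrite big_cons -IHs -expectationD//.
  by congr expectation; apply/funext => t; rewrite big_cons.
rewrite (_ : (fun _ => _) = \sum_(i <- s) F i); last first.
  by apply/funext => t; rewrite fct_sumE.
by apply: rpred_sum => i' _; exact: F1.
Qed.

(** The usual formula for the variance, solved for the second moment, all terms being finite. *)
Lemma expectation_sqr X : X \in Lfun P 2%:E ->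
  ('E_P[(X ^+ 2)%R])%E = (fine (covariance P X X) + fine 'E_P[X] ^+ 2)%:E.
Proof.
move=> X2; have E1 := expectation_fin_num (Lfun2_Lfun1 X2).
rewrite EFinD fineK ?covariance_fin_num2// -/(variance P X) varianceE//.
by rewrite EFin_expe fineK// subeK// fin_numX.
Qed.

(** Cauchy-Schwarz. [covariance_le] bounds the covariance from above only, so it is applied to [Y]
    and to its opposite. *)
Lemma covariance_eq0 X Y : X \in Lfun P 2%:E -> Y \in Lfun P 2%:E ->
  fine (covariance P X X) = 0 -> fine (covariance P X Y) = 0.
Proof.
move=> X2 Y2 X0.
have ub Z : Z \in Lfun P 2%:E -> fine (covariance P X Z) <= 0.
  move=> Z2; rewrite -lee_fin fineK ?covariance_fin_num2//.
  have := covariance_le X2 Z2.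
  rewrite /variance -[covariance P X X]fineK ?covariance_fin_num2// X0.
  by rewrite /= sqrtr0 mul0e.
apply/eqP; rewrite eq_le ub//= -oppr_le0.
have := ub _ (Lfun2_scale (-1) Y2); rewrite covarianceC fine_covarianceZl//.
by rewrite mulN1r covarianceC.
Qed.

End RealCovariance.

(** * Means and covariance matrices of random vectors under affine maps *)

Section RandomVectorCovariance.
Context {d : measure_display} {T : measurableType d} {R : realType}.
Variable P : probability T R.

Section SecondMoment.
Context {N : nat}.
Implicit Types a b : T -> 'cV[R]_N.

Lemma finite_second_moment_mulmx M (A : 'M[R]_(M, N)) a :
  finite_second_moment P a -> finite_second_moment P (fun t => A *m a t).
Proof.
move=> a2 i; rewrite (_ : (fun _ => _) =
  fun t => \sum_j ((A i j \o* (fun t => a t j 0)) t)).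
  by apply: Lfun2_sum => j; exact: Lfun2_scale.
by apply/funext => t; rewrite mxE; apply: eq_bigr => j _; rewrite /= mulrC.
Qed.

Lemma finite_second_momentD a b : finite_second_moment P a ->
  finite_second_moment P b -> finite_second_moment P (fun t => a t + b t).
Proof.
move=> a2 b2 i; rewrite (_ : (fun _ => _) =
  (fun t => a t i 0) + (fun t => b t i 0)); first by apply: rpredD; rewrite ?lee1n.
by apply/funext => t; rewrite mxE.
Qed.

Lemma finite_second_moment_cst (c : 'cV[R]_N) :
  finite_second_moment P (fun=> c).
Proof. by move=> i; exact: Lfun_cst. Qed.

Lemma mean_mulmx M (A : 'M[R]_(M, N)) a : finite_second_moment P a ->
  mean P (fun t => A *m a t) = A *m mean P a.
Proof.
move=> a2; apply/colP => i; rewrite !mxE.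
rewrite (_ : (fun _ => _) =
    fun t => \sum_j ((A i j \o* (fun t => a t j 0)) t)); last first.
  by apply/funext => t; rewrite mxE; apply: eq_bigr => j _; rewrite /= mulrC.
have a1 j : (fun t => a t j 0) \in Lfun P 1 by exact: Lfun2_Lfun1.
rewrite expectation_sum_fun; last first.
  by move=> j; apply/Lfun2_Lfun1/Lfun2_scale.
transitivity (fine (\sum_j (A i j * mean P a j 0)%:E)%E).
  congr fine; apply: eq_bigr => j _.
  by rewrite expectationZl// mxE EFinM fineK// expectation_fin_num.
by rewrite sumEFin.
Qed.

Lemma meanD a b : finite_second_moment P a -> finite_second_moment P b ->
  mean P (fun t => a t + b t) = mean P a + mean P b.
Proof.
move=> a2 b2; apply/colP => i; rewrite !mxE -fineD; last 2 first.
- exact/expectation_fin_num/Lfun2_Lfun1.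
- exact/expectation_fin_num/Lfun2_Lfun1.
rewrite -expectationD ?Lfun2_Lfun1//.
by congr (fine (expectation _ _)); apply/funext => t; rewrite mxE.
Qed.

Lemma mean_cst (c : 'cV[R]_N) : mean P (fun=> c) = c.
Proof. by apply/colP => i; rewrite mxE (expectation_cst P (c i 0)). Qed.

End SecondMoment.

Section Bilinearity.
Context {N M : nat}.
Implicit Types (a : T -> 'cV[R]_N) (b : T -> 'cV[R]_M).

Lemma tr_cov a b : (cov P a b)^T = cov P b a.
Proof. by apply/matrixP => i j; rewrite !mxE covarianceC. Qed.

Lemma cov_cstl (c : 'cV[R]_N) b : cov P (fun=> c) b = 0.
Proof.
by apply/matrixP => i j; rewrite !mxE (covariance_cst_l P (c i 0)).
Qed.

Lemma covDl a a' b : finite_second_moment P a -> finite_second_moment P a' ->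
    finite_second_moment P b ->
  cov P (fun t => a t + a' t) b = cov P a b + cov P a' b.
Proof.
move=> a2 a'2 b2; apply/matrixP => i j; rewrite !mxE -fine_covarianceDl//.
by congr (fine (covariance _ _ _)); apply/funext => t; rewrite mxE.
Qed.

Lemma cov_mulmxl K (A : 'M[R]_(K, N)) a b : finite_second_moment P a ->
    finite_second_moment P b ->
  cov P (fun t => A *m a t) b = A *m cov P a b.
Proof.
move=> a2 b2; apply/matrixP => i j; rewrite !mxE.
rewrite (_ : (fun _ => (A *m _) _ _) =
    fun t => \sum_k ((A i k \o* (fun t => a t k 0)) t)); last first.
  by apply/funext => t; rewrite mxE; apply: eq_bigr => k _; rewrite /= mulrC.
rewrite fine_covariance_suml//; last by move=> k; exact: Lfun2_scale.
by apply: eq_bigr => k _; rewrite fine_covarianceZl// mxE.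
Qed.

End Bilinearity.

Lemma covDr N M (a : T -> 'cV[R]_N) (b b' : T -> 'cV[R]_M) :
    finite_second_moment P a -> finite_second_moment P b ->
    finite_second_moment P b' ->
  cov P a (fun t => b t + b' t) = cov P a b + cov P a b'.
Proof. by move=> *; rewrite -tr_cov covDl// raddfD /= !tr_cov. Qed.

Lemma cov_cstr N M (a : T -> 'cV[R]_N) (c : 'cV[R]_M) : cov P a (fun=> c) = 0.
Proof. by rewrite -tr_cov cov_cstl trmx0. Qed.

Lemma cov_mulmxr N M K (A : 'M[R]_(K, M)) (a : T -> 'cV[R]_N)
    (b : T -> 'cV[R]_M) :
    finite_second_moment P a -> finite_second_moment P b ->
  cov P a (fun t => A *m b t) = cov P a b *m A^T.
Proof. by move=> *; rewrite -tr_cov cov_mulmxl// trmx_mul tr_cov. Qed.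

Lemma tr_cov_ge0 N (a : T -> 'cV[R]_N) : 0 <= \tr (cov P a a).
Proof.
by apply: sumr_ge0 => i _; rewrite mxE fine_ge0// variance_ge0.
Qed.

(** The trace is a sum of non-negative variances, so each of them vanishes and [covariance_eq0]
    applies entrywise. *)
Lemma tr_cov_eq0 N M (a : T -> 'cV[R]_N) (b : T -> 'cV[R]_M) :
    finite_second_moment P a -> finite_second_moment P b ->
  \tr (cov P a a) = 0 -> cov P a b = 0.
Proof.
move=> a2 b2 tr0; apply/matrixP => i j; rewrite !mxE.
apply: covariance_eq0 => //.
have /psumr_eq0P/(_ i isT) : \sum_i cov P a a i i = 0 by [].
rewrite mxE; apply => k _.
by rewrite mxE fine_ge0// variance_ge0.
Qed.

(** Bias-variance decomposition: summed over coordinates, the variances form the trace and the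
    squared means the bias term. *)
Lemma expectation_sqnorm N (e : T -> 'cV[R]_N) : finite_second_moment P e ->
  ('E_P[fun t => sqnorm (e t)])%E = (\tr (cov P e e) + sqnorm (mean P e))%:E.
Proof.
move=> e2; rewrite /sqnorm (expectation_sum_fun _ (F := fun i t => e t i 0 ^+ 2)).
  rewrite /mxtrace -big_split /= -sumEFin; apply: eq_bigr => i _.
  by rewrite !mxE -expectation_sqr.
by move=> i; exact: (Lfun2_mul_Lfun1 (e2 i) (e2 i)).
Qed.

End RandomVectorCovariance.

(** * Squared Euclidean norm and quotients of diagonal matrices *)

Lemma sqnorm_ge0 (R : realType) N (a : 'cV[R]_N) : 0 <= sqnorm a.
Proof. by apply: sumr_ge0 => i _; exact: sqr_ge0. Qed.

Lemma sqnorm_eq0 (R : realType) N (a : 'cV[R]_N) : sqnorm a = 0 -> a = 0.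
Proof.
move=> /psumr_eq0P a0; apply/colP => i; apply/eqP; rewrite mxE -sqrf_eq0.
by apply/eqP/a0 => // j _; exact: sqr_ge0.
Qed.

Lemma sqnorm0 (R : realType) N : sqnorm (0 : 'cV[R]_N) = 0.
Proof. by apply: big1 => i _; rewrite mxE expr0n. Qed.

(** Serves to recognize the GSP-LMMSE gain as a diagonal filter in the Fourier basis. *)
Lemma mulmx_diag_invmx (F : fieldType) n (u v : 'rV[F]_n) :
  diag_mx v \in unitmx ->
  diag_mx u *m invmx (diag_mx v) = diag_mx (\row_i (u 0 i / v 0 i)).
Proof.
move=> v_unit; have v0 i : v 0 i != 0.
  by move: v_unit; rewrite unitmxE det_diag unitfE => /prodf_neq0 ->.
rewrite -[RHS](mulmxK v_unit) mulmx_diag; congr (diag_mx _ *m _).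
by apply/rowP => i; rewrite !mxE divfK.
Qed.

(** * Optimality and uniqueness of the LMMSE estimator among affine ones *)

Section LMMSE.
Context {d : measure_display} {T : measurableType d} {R : realType} {N : nat}.
Variables (P : probability T R) (x y : T -> 'cV[R]_N).
Hypotheses (x2 : finite_second_moment P x) (y2 : finite_second_moment P y).
Hypothesis (Cyy : cov P y y \in unitmx).

(** The excess over the LMMSE error splits into a variance part, due to the wrong gain, and the
    squared bias of the estimator. *)
Lemma mse_affine (A : 'M[R]_N) (b : 'cV[R]_N) :
  let B := A - cov P x y *m invmx (cov P y y) in
  mse P x y (fun u => A *m u + b) = (mse P x y (lmmse P x y) +
    (\tr (cov P (fun t => B *m y t) (fun t => B *m y t)) +
     sqnorm (A *m mean P y + b - mean P x))%:E)%E.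
Proof.
set A0 := _ *m _ => B.
(* [A0] and [c0] are the gain and offset of the LMMSE estimator, [e0] is its error, and [D] is what
   the competing estimate adds to it. Subtraction of [x] is written as a product by [(-1)%:M] so
   that the rules for [*m] cover it. *)
pose c0 := mean P x - A0 *m mean P y.
pose e0 t := (A0 *m y t + c0) + (-1)%:M *m x t.
pose By t := B *m y t.
pose D t := By t + (b - c0).
have A0y2 : finite_second_moment P (fun t => A0 *m y t).
  exact: finite_second_moment_mulmx.
have By2 : finite_second_moment P By by exact: finite_second_moment_mulmx.
have mx2 : finite_second_moment P (fun t => (-1)%:M *m x t).
  exact: finite_second_moment_mulmx.
have cst2 c : finite_second_moment P (fun=> c : 'cV[R]_N).
  exact: finite_second_moment_cst.
have A0yc2 : finite_second_moment P (fun t => A0 *m y t + c0).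
  exact: finite_second_momentD.
have e02 : finite_second_moment P e0 by exact: finite_second_momentD.
have D2 : finite_second_moment P D by exact: finite_second_momentD.
have mean_e0 : mean P e0 = 0.
  rewrite meanD// meanD// mean_cst !mean_mulmx// mul_scalar_mx scaleN1r.
  by rewrite /c0 subrKC subrr.
(* The normal equation: [A0] times [cov P y y] is [cov P x y]. *)
have cov_e0y : cov P e0 y = 0.
  rewrite covDl// covDl// cov_cstl !cov_mulmxl// mulmxKV// addr0.
  by rewrite mul_scalar_mx scaleN1r subrr.
have cov_e0D : cov P e0 D = 0.
  by rewrite covDr// cov_cstr cov_mulmxr// cov_e0y mul0mx addr0.
have lmmseE : mse P x y (lmmse P x y) = (\tr (cov P e0 e0))%:E.
  (* The zero bias of [e0] is inserted to match the right-hand side of [expectation_sqnorm]. *)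
  rewrite -[\tr _]addr0 -[X in _ + X](sqnorm0 R N) -mean_e0.
  rewrite -expectation_sqnorm//; congr expectation; apply/funext => t.
  congr sqnorm; rewrite /lmmse /e0 /c0 -/A0 mul_scalar_mx scaleN1r mulmxBr.
  by rewrite addrCA.
have -> : mse P x y (fun u => A *m u + b) =
    ('E_P[fun t => sqnorm (e0 t + D t)])%E.
  congr expectation; apply/funext => t; congr sqnorm.
  rewrite /e0 /D /By mul_scalar_mx scaleN1r [in RHS]addrAC mulmxBl; congr (_ - _).
  by rewrite addrACA !subrKC.
have eD2 : finite_second_moment P (fun t => e0 t + D t).
  exact: finite_second_momentD.
rewrite expectation_sqnorm// lmmseE -EFinD addrA; congr (_ + _)%:E.
  (* Both cross terms vanish by [cov_e0D], and the constant [b - c0] drops out of the covariance of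
     [D]. *)
  rewrite (covDl e02 D2 eD2) (covDr e02 e02 D2) (covDr D2 e02 D2).
  rewrite cov_e0D -[cov P D e0]tr_cov cov_e0D trmx0 addr0 add0r mxtraceD.
  rewrite (covDl By2 (cst2 _) D2) cov_cstl addr0.
  by rewrite (covDr By2 By2 (cst2 _)) cov_cstr addr0.
rewrite meanD// mean_e0 add0r meanD// mean_cst mean_mulmx//; congr sqnorm.
by rewrite /c0 mulmxBl opprB addrACA addKr.
Qed.

Lemma lmmse_affine : affine_estimator (lmmse P x y).
Proof.
set A := cov P x y *m invmx (cov P y y).
exists A, (mean P x - A *m mean P y); apply/funext => u.
by rewrite /lmmse -/A mulmxBr addrCA.
Qed.

(** Finiteness allows this term to be cancelled in the extended reals when proving uniqueness. *)
Lemma mse_lmmse_fin_num : mse P x y (lmmse P x y) \is a fin_num.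
Proof.
case: lmmse_affine => A [b lE].
rewrite /mse lE expectation_sqnorm//.
rewrite (_ : (fun _ => _) = fun t => (A *m y t + b) + (-1)%:M *m x t).
  by do 2?apply: finite_second_momentD; try exact: finite_second_moment_cst;
    exact: finite_second_moment_mulmx.
by apply/funext => t; rewrite mul_scalar_mx scaleN1r.
Qed.

Lemma mse_lmmse_le h : affine_estimator h ->
  (mse P x y (lmmse P x y) <= mse P x y h)%E.
Proof.
case=> A [b ->]; rewrite mse_affine leeDl// lee_fin.
by rewrite addr_ge0 ?tr_cov_ge0 ?sqnorm_ge0.
Qed.

Lemma mse_le_lmmse h : affine_estimator h ->
  (mse P x y h <= mse P x y (lmmse P x y))%E -> h = lmmse P x y.
Proof.
case=> A [b ->]; rewrite mse_affine; set B := A - _; set trB := \tr _.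
rewrite -{2}[mse _ _ _ _]adde0 leeD2lE ?mse_lmmse_fin_num// lee_fin => le0.
have trB0 : 0 <= trB by exact: tr_cov_ge0.
have m0 := sqnorm_ge0 (A *m mean P y + b - mean P x).
have /eqP : trB + sqnorm (A *m mean P y + b - mean P x) = 0.
  by apply/eqP; rewrite eq_le le0 addr_ge0.
rewrite paddr_eq0// => /andP[/eqP trBE /eqP /sqnorm_eq0 mE].
have By2 : finite_second_moment P (fun t => B *m y t).
  exact: finite_second_moment_mulmx.
(* Zero variance of [B *m y] forces [B *m cov P y y = 0], hence [B = 0] by invertibility; zero bias
   [mE] then determines the offset [b]. *)
have := tr_cov_eq0 By2 y2 trBE; rewrite cov_mulmxl// => BC0.
have /subr0_eq AE : B = 0 by rewrite -[B](mulmxK Cyy) BC0 mul0mx.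
apply/funext => u; rewrite /lmmse -AE -(subr0_eq mE) mulmxBr.
by rewrite [RHS]addrC addrA subrK.
Qed.

Lemma is_lmmseE h : is_lmmse P x y h <-> h = lmmse P x y.
Proof.
split=> [[hA hle]|->].
  exact/mse_le_lmmse/hle/lmmse_affine.
by split; [exact: lmmse_affine|exact: mse_lmmse_le].
Qed.

End LMMSE.

(** * Comparison of the two estimators through the orthogonal change of basis [V] *)

Theorem theorem1 (R : realType) (N : nat) (hN : (0 < N)%N)
  (W V : 'M[R]_N) (lam : 'rV[R]_N)
  (hW : connected_weighted_graph W) (hV : laplacian_evd W V lam)
  (d : measure_display) (T : measurableType d) (P : probability T R)
  (g : 'M[R]_N -> 'cV[R]_N -> 'cV[R]_N)
  (hg : measurable_fun [set: borel 'M[R]_N * borel 'cV[R]_N]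
          ((fun p => g p.1 p.2)
             : borel 'M[R]_N * borel 'cV[R]_N -> borel 'cV[R]_N))
  (x w y : T -> 'cV[R]_N)
  (hx : random_vector x) (hw : random_vector w)
  (hx2 : finite_second_moment P x) (hw2 : finite_second_moment P w)
  (hy2 : finite_second_moment P y)
  (hw0 : mean P w = 0) (hind : independent P w x)
  (hy : forall t, y t = g (laplacian W) (x t) + w t)
  (hC : cov P (gft V \o y) (gft V \o y) \in unitmx)
  (hD : diag_mx (diagv (cov P (gft V \o y) (gft V \o y))) \in unitmx)
  (hcond : cov P (gft V \o x) (gft V \o y)
             *m invmx (cov P (gft V \o y) (gft V \o y))
           = diag_mx (diagv (cov P (gft V \o x) (gft V \o y)))
             *m invmx (diag_mx (diagv (cov P (gft V \o y) (gft V \o y))))) :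
  [/\ forall h, is_lmmse P x y h <-> h = lmmse P x y,
      forall h, is_gsp_lmmse P V x y h <-> h = gsp_lmmse P V x y
    & gsp_lmmse P V x y = lmmse P x y].
Proof.
have VVT := evd_orthogonal hV.
have VTV : V *m V^T = 1%:M by exact: mulmx1C.
have covV a b : finite_second_moment P a -> finite_second_moment P b ->
    cov P (gft V \o a) (gft V \o b) = V^T *m cov P a b *m V.
  move=> a2 b2; rewrite cov_mulmxl//; last exact: finite_second_moment_mulmx.
  by rewrite cov_mulmxr// trmxK mulmxA.
have Vu : V \in unitmx by case/mulmx1_unit: VTV.
have VTu : V^T \in unitmx by rewrite unitmx_tr.
have Cyy : cov P y y \in unitmx.
  by move: hC; rewrite covV// !unitmx_mul VTu Vu andbT.
have invCE : invmx (cov P (gft V \o y) (gft V \o y)) =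
    V^T *m invmx (cov P y y) *m V.
  (* Both sides are compared after left multiplication by the invertible transformed covariance,
     where each gives the identity. *)
  apply: (can_inj (mulKmx hC)); rewrite mulmxV// covV//.
  by rewrite !mulmxA -[_ *m V *m V^T]mulmxA VTV mulmx1 mulmxK.
have gsp_eq : gsp_lmmse P V x y = lmmse P x y.
  apply/funext => u; rewrite /gsp_lmmse /lmmse /=; congr (_ + _ *m _).
  (* [hcond] replaces the diagonal filter by the full transformed gain; the inner factors [V *m V^T]
     then cancel. *)
  rewrite -[_ *m invmx (diag_mx _)]mulmxA -hcond invCE covV// !mulmxA VTV mul1mx.
  rewrite -[_ *m V *m V^T]mulmxA VTV mulmx1.
  by rewrite -[_ *m V *m V^T]mulmxA VTV mulmx1.
have lE := is_lmmseE hx2 hy2 Cyy.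
have gsp_affine h : gsp_estimator V h -> affine_estimator h.
  by case=> f [b ->]; exists (V *m diag_mx f *m V^T), b.
have gsp_gsp : gsp_estimator V (gsp_lmmse P V x y).
  (* The filter is the scalar LMMSE gain at each graph frequency: covariance over variance. *)
  pose f := \row_i (diagv (cov P (gft V \o x) (gft V \o y)) 0 i /
                    diagv (cov P (gft V \o y) (gft V \o y)) 0 i).
  exists f, (mean P x - V *m diag_mx f *m V^T *m mean P y).
  apply/funext => u; rewrite /gsp_lmmse /=.
  by rewrite -[V *m _ *m invmx _]mulmxA mulmx_diag_invmx// mulmxBr addrCA.
split=> // h; split=> [[hG hle]|->].
  (* An optimal GSP estimator does at least as well as [gsp_lmmse], which is admissible by [gsp_gsp]
     and equals [lmmse], so affine uniqueness identifies it. *)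
  rewrite gsp_eq; apply: mse_le_lmmse => //; first exact: gsp_affine.
  by rewrite -gsp_eq; exact: hle.
split=> // h' /gsp_affine hA.
by rewrite gsp_eq; exact: mse_lmmse_le.
Qed.
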